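(* Let $D\subset\mathbf{R}^2$, let $f:D\to\mathbf{R}$ be a function, let $P_0=(x_0,y_0)\in\mathbf{R}^2$ be an accumulation point of $D$, and let $L$ be a real constant. Then $\lim_{P\to P_0,\,P\in D} f(P)=L$ if and only if the following condition holds: for every constant $\phi_0\in[0,2\pi]$ and all real sequences $\{r_n\}$, $\{\phi_n\}$ with $\lim_{n\to\infty} r_n=0$ and $\lim_{n\to\infty}\phi_n=\phi_0$ such that the points $P_n=(x_0+r_n\cos\phi_n,\;y_0+r_n\sin\phi_n)$ all belong to $D$, one has $\lim_{n\to\infty} f(P_n)=L$.
   Context: The limit $\lim_{P\to P_0,\,P\in D} f(P)=L$ means: $P_0$ is an accumulation point of $D$ and for every $\varepsilon>0$ there is a punctured neighborhood $U_0(P_0,r)=\{P\in\mathbf{R}^2: 0<|P-P_0|<r\}$, $r>0$, such that $|f(P)-L|<\varepsilon$ for all $P\in U_0(P_0,r)\cap D$.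
   Formalization: The sequences r_n are required to be nonzero for every n; without this the claim fails when P_0 lies in D and f(P_0) differs from L (e.g. D = R^2, f the indicator of P_0, L = 0). If P_0 is not in D this is automatic. *)

(* Defs.v *)
From HB Require Import structures.
From mathcomp Require Import all_boot all_order all_algebra.
From mathcomp Require Import all_classical all_reals all_analysis.
Set Implicit Arguments.
Unset Strict Implicit.
Unset Printing Implicit Defensive.
Import Order.TTheory GRing.Theory Num.Theory.
Import numFieldNormedType.Exports.
Local Open Scope classical_set_scope.
Local Open Scope ring_scope.

(* The norm that the library puts on R * R is the max norm, so the Euclidean
   distance is spelled out. *)
Definition dist2 (R : realType) (P Q : R * R) : R :=
  Num.sqrt ((P.1 - Q.1) ^+ 2 + (P.2 - Q.2) ^+ 2).

Definition punctured_disc (R : realType) (P0 : R * R) (r : R) : set (R * R) :=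
  [set P | 0 < dist2 P P0 < r].

(* The domain of f is D itself, seen as a type; [val P] is the point of the
   plane underlying P : D. *)
Definition limit_in (R : realType) (D : set (R * R)) (f : D -> R)
    (P0 : R * R) (L : R) : Prop :=
  limit_point D P0 /\
  forall eps : R, 0 < eps ->
    exists2 r : R, 0 < r &
      forall P : D, punctured_disc P0 r (val P) -> `|f P - L| < eps.

Definition polar_point (R : realType) (P0 : R * R) (r phi : R) : R * R :=
  (P0.1 + r * cos phi, P0.2 + r * sin phi).

(* P is the sequence of the polar points, taken in D. The radii may be negative
   but not zero: limits are punctured, so the value of f at P0, if P0 lies in D,
   must not be sampled. *)
Definition polar_sequential_limit (R : realType) (D : set (R * R))
    (f : D -> R) (P0 : R * R) (L : R) : Prop :=
  forall phi0 : R, 0 <= phi0 <= 2 * pi ->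
  forall r phi : nat -> R,
    r n @[n --> \oo] --> (0 : R) ->
    phi n @[n --> \oo] --> phi0 ->
    (forall n, r n != 0) ->
    forall P : nat -> D,
      (forall n, val (P n) = polar_point P0 (r n) (phi n)) ->
      f (P n) @[n --> \oo] --> L.

(* Main.v *)
(** If the limit fails, some eps > 0 is defeated by points P_n of D tending to
    P0 and distinct from it. Their polar angles can be taken in [0, 2 pi], so by
    Bolzano-Weierstrass a subsequence of the angles converges, and along it the
    sequential condition contradicts the choice of P_n. *)
Require Import Defs.
From mathcomp Require Import all_boot all_order all_algebra.
From mathcomp Require Import all_classical all_reals all_analysis.
From mathcomp Require Import ring lra.
Import Order.TTheory GRing.Theory Num.Theory.
Import numFieldNormedType.Exports.
Local Open Scope classical_set_scope.
Local Open Scope ring_scope.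

Lemma dist2_polar_point (R : realType) (P0 : R * R) (r phi : R) :
  dist2 (polar_point P0 r phi) P0 = `|r|.
Proof.
rewrite /dist2 /polar_point /= !(addrC _ (r * _)) !addrK !exprMn -mulrDr.
by rewrite cos2Dsin2 mulr1 sqrtr_sqr.
Qed.

(** [acos c] has cosine [c] and sine [|s|], which settles [0 <= s]; for [s < 0], reflecting it to
    [2 * pi - acos c] keeps the cosine and flips the sine. *)
Lemma circle_angle (R : realType) (c s : R) : c ^+ 2 + s ^+ 2 = 1 ->
  exists2 phi : R, 0 <= phi <= 2 * pi & cos phi = c /\ sin phi = s.
Proof.
move=> cs1.
have c_itv : -1 <= c <= 1.
  rewrite -ler_norml -(@expr_le1 _ 2)// real_normK ?num_real//.
  by rewrite -cs1 lerDl sqr_ge0.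
have a0 := acos_ge0 c_itv; have api := acos_lepi c_itv.
have cosa : cos (acos c) = c by rewrite acosK// in_itv.
have sina : sin (acos c) = `|s|.
  by rewrite sin_acos// -sqrtr_sqr; congr Num.sqrt; lra.
have [s0|s0] := leP 0 s.
  exists (acos c); first by lra.
  by rewrite sina ger0_norm.
exists (pi *+ 2 - acos c); first by rewrite -mulr_natl; lra.
by rewrite addrC cosD2pi sinD2pi cosN sinN cosa sina ltr0_norm// opprK.
Qed.

Lemma polar_coordinates (R : realType) (P P0 : R * R) :
  exists2 phi : R, 0 <= phi <= 2 * pi & P = polar_point P0 (dist2 P P0) phi.
Proof.
case: P P0 => [x y] [x0 y0]; rewrite /dist2 /polar_point /=.
set d := Num.sqrt _.
have d2 : d ^+ 2 = (x - x0) ^+ 2 + (y - y0) ^+ 2.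
  by rewrite sqr_sqrtr// addr_ge0// sqr_ge0.
clearbody d.
(* At the centre every angle works, so 0 is an arbitrary pick; elsewhere dividing by [d] lands on
   the unit circle. *)
have [d0|d0] := eqVneq d 0.
  exists 0; first by rewrite lexx mulr_ge0// pi_ge0.
  move/esym/eqP: d2; rewrite d0 expr0n/= paddr_eq0 ?sqr_ge0// !sqrf_eq0 !subr_eq0.
  by move=> /andP[/eqP-> /eqP->]; rewrite !mul0r !addr0.
have [|phi phi_itv [cosE sinE]] := @circle_angle _ ((x - x0) / d) ((y - y0) / d).
  by rewrite !expr_div_n -mulrDl -d2 divff// expf_neq0.
by exists phi => //; rewrite cosE sinE; congr pair; field.
Qed.

Lemma leq_increasing_seq (k : nat -> nat) (n : nat) :
  increasing_seq k -> (n <= k n)%N.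
Proof.
move=> /increasing_seqP k_incr; elim: n => // n IHn.
exact: leq_ltn_trans IHn (k_incr n).
Qed.

Theorem theorem1 (R : realType) (D : set (R * R)) (f : D -> R)
    (x0 y0 : R) (L : R) (hP0 : limit_point D (x0, y0)) :
  limit_in f (x0, y0) L <-> polar_sequential_limit f (x0, y0) L.
Proof.
split=> [[_ lim_f] phi0 _ r phi r0 _ rN0 P PE|seq_f].
  (* [P n] is at distance [|r n|] from the centre: eventually less than [d], and never 0. *)
  apply/cvgrPdist_lt => eps /lim_f[d d0 fd].
  move: r0 => /cvgr0_norm_lt /(_ d d0); apply: filterS => n rd.
  rewrite distrC; apply: fd.
  by rewrite PE /punctured_disc /= dist2_polar_point normr_gt0 rN0.
split=> // eps eps0; apply: contrapT => no_d.
(* The radii [harmonic n], that is [1 / (n + 1)], are positive already at [n = 0]. *)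
have bad n : exists P : D,
    0 < dist2 (val P) (x0, y0) < harmonic n /\ eps <= `|f P - L|.
  apply: contrapT => noP; apply: no_d; exists (harmonic n).
    exact: harmonic_gt0.
  move=> P PD.
  by rewrite ltNge; apply/negP => fP; apply: noP; exists P.
have [P PE] := choice bad.
have polar n := cid2 (polar_coordinates _ (val (P n)) (x0, y0)).
pose phi n := s2val (polar n).
have phi_itv n : 0 <= phi n <= 2 * pi by exact: s2valP (polar n).
have [|k k_incr phi_cvg] := @bolzano_weierstrass _ phi.
  exists (2 * pi); split; first exact: num_real.
  move=> M piM n _ /=; have /andP[phi0 phi2pi] := phi_itv n.
  by rewrite ger0_norm// (le_trans phi2pi)// ltW.
have fk : f (P (k n)) @[n --> \oo] --> L.
  apply: (seq_f (limn (phi \o k)) _ (fun n => dist2 (val (P (k n))) (x0, y0))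
    (phi \o k)) => //.
  (* The limit angle stays in the closed interval from 0 to [2 * pi]. *)
  - apply/andP; split.
      by apply: limr_ge => //; apply: nearW => n; case/andP: (phi_itv (k n)).
    by apply: limr_le => //; apply: nearW => n; case/andP: (phi_itv (k n)).
  (* Since [n <= k n], the distance is below [1 / (k n + 1) <= 1 / (n + 1)]. *)
  - apply: (squeeze_cvgr _ (cvg_cst 0) cvg_harmonic).
    apply: nearW => n; have [/andP[d0 dk] _] := PE (k n).
    rewrite (ltW d0) (le_trans (ltW dk))// lef_pV2 ?posrE ?ltr0n//.
    by rewrite ler_nat ltnS leq_increasing_seq.
  - by move=> n; have [/andP[d0 _] _] := PE (k n); rewrite gt_eqF.
  - by move=> n; exact: s2valP' (polar (k n)).
(* One index [N] past the threshold for [eps] suffices: [P (k N)] was chosen with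
   [eps <= |f (P (k N)) - L|]. *)
move/cvgrPdist_lt : fk => /(_ _ eps0)[N _ /(_ N (leqnn N))] /=.
by rewrite distrC ltNge; have [_ ->] := PE (k N).
Qed.
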